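(* Let $a,b,c$ be $F$-continuous real functions on $F\cap[a_0,b_0]$, with neither $b$ nor $c$ identically zero, and consider the Riccati-type fractal differential equation $$D^{\alpha}_F y(t)=a(t)\,y(t)+b(t)\,y^2(t)+c(t),\qquad t\in F\cap[a_0,b_0].\qquad (R)$$ Let $u$ be a particular solution of $(R)$. Then each solution $y$ of $(R)$ has the form $$y(t)=u(t)+\frac{1}{v(t)},\qquad t\in F\cap[a_0,b_0],$$ where $v$ is a solution of the linear fractal differential equation $$D^{\alpha}_F v(t)=-\bigl(a(t)+2b(t)u(t)\bigr)v(t)-b(t),\qquad t\in F\cap[a_0,b_0].$$
   Context: Setting: $\alpha\in(0,1]$; $F\subset\mathbb{R}$ is a compact $\alpha$-perfect set of fractal (Hausdorff) dimension $\alpha$; $[a_0,b_0]$ is an interval with $F\cap[a_0,b_0]\neq\emptyset$. Let $\mathcal{H}^\alpha$ be the $\alpha$-dimensional Hausdorff measure, $\mathcal{H}^\alpha(A)=\lim_{\delta\to0}\inf\{\sum_i(\mathrm{diam}A_i)^\alpha: A\subset\bigcup_i A_i,\ \mathrm{diam}A_i\le\delta\}$. Fix $p\in[a_0,b_0]$. The staircase function is $S^\alpha_F(t)=\Gamma(\alpha+1)\mathcal{H}^\alpha(F\cap[p,t])$ if $t\ge p$ and $S^\alpha_F(t)=-\Gamma(\alpha+1)\mathcal{H}^\alpha(F\cap[t,p])$ if $t<p$. That $F$ is $\alpha$-perfect means that $S^\alpha_F$ is finite and $F$ is exactly the set of points at which $S^\alpha_F$ is not locally constant, this set being closed and without isolated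 points. $F$-limit: $F\text{-}\lim_{y\to t} g(y)=\ell$ means the limit along $y\in F\cap[a_0,b_0]$, $y\ne t$: for every $\varepsilon>0$ there is $\delta>0$ with $|g(y)-\ell|<\varepsilon$ whenever $y\in F\cap[a_0,b_0]$, $0<|y-t|<\delta$. A function $f$ is $F$-continuous if $F\text{-}\lim_{y\to t}f(y)=f(t)$ for every $t\in F\cap[a_0,b_0]$. Fractal derivative: for $f:[a_0,b_0]\to\mathbb{R}$, $D^\alpha_Ff(t)=F\text{-}\lim_{y\to t}\frac{f(y)-f(t)}{S^\alpha_F(y)-S^\alpha_F(t)}$ if $t\in F\cap[a_0,b_0]$ (when this limit exists), and $D^\alpha_Ff(t)=0$ if $t\in[a_0,b_0]\setminus F$. $f$ is $F^\alpha$-derivable if it has a fractal derivative at every point. A solution of a fractal differential equation is an $F^\alpha$-derivable function satisfying the equation at every point of $F\cap[a_0,b_0]$.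
   Formalization: The formal theorem assumes in addition that y(t) ≠ u(t) for every t in F∩[a0,b0]; without this the claim fails (for example y = u), and the condition is necessary for y = u + 1/v with real-valued v. *)

(* Defs.v *)
From HB Require Import structures.
From mathcomp Require Import all_boot all_order all_algebra.
From mathcomp Require Import all_classical all_reals all_analysis.
Set Implicit Arguments.
Unset Strict Implicit.
Unset Printing Implicit Defensive.
Import Order.TTheory GRing.Theory Num.Theory.
Import numFieldNormedType.Exports.
Local Open Scope classical_set_scope.
Local Open Scope ring_scope.

Section hausdorff.
Context {R : realType}.
Implicit Types (s delta : R) (A : set R).

(* The point 0 is added so that the empty set has diameter 0 rather than -oo. *)
Definition diam A : \bar R :=
  ereal_sup (0%E |` [set `|x.1 - x.2|%:E | x in A `*` A]).

(* Only used for 0 < s, where [0 `^ s = 0]: the empty set may then be used as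
   padding, so that countable covers include the finite ones. *)
Definition hausdorff_content s delta A : \bar R :=
  ereal_inf [set (\sum_(0 <= i <oo) (diam (B i) `^ s))%E | B in
    [set B : (set R)^nat | A `<=` \bigcup_i B i /\
                           forall i, (diam (B i) <= delta%:E)%E]].

Definition hausdorff_measure s A : \bar R :=
  lim (hausdorff_content s delta A @[delta --> 0^'+]).

(* Restricting to 0 < s does not change the infimum. *)
Definition hausdorff_dim A : \bar R :=
  ereal_inf [set s%:E | s in [set s : R | 0 < s /\ hausdorff_measure s A = 0%E]].

End hausdorff.

Definition Gamma {R : realType} (x : R) : R :=
  \int[lebesgue_measure]_(t in `]0, +oo[) (t `^ (x - 1) * expR (- t)).

Section staircase.
Context {R : realType}.
Implicit Types (F : set R) (alpha p t : R).

Definition estaircase F alpha p t : \bar R :=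
  if p <= t then ((Gamma (alpha + 1))%:E * hausdorff_measure alpha (F `&` `[p, t]))%E
  else (- ((Gamma (alpha + 1))%:E * hausdorff_measure alpha (F `&` `[t, p])))%E.

(* Meaningful when the extended-real staircase is finite, which is part of
   [alpha_perfect]. *)
Definition staircase F alpha p t : R := fine (estaircase F alpha p t).

Definition alpha_perfect F alpha p : Prop :=
  [/\ forall t, estaircase F alpha p t \is a fin_num,
      F = [set t | ~ \forall s \near t,
                       staircase F alpha p s = staircase F alpha p t]
    & perfect_set F].

End staircase.

(* Functions on [a0, b0] or on F `&` [a0, b0] are represented by total functions
   whose values elsewhere are never used. *)
Section fractal_derivative.
Context {R : realType}.
Variables (F : set R) (alpha p a0 b0 : R).
Implicit Types (f g : R -> R) (t l : R).

(* If t is not a limit point of F `&` [a0, b0], every l is an F-limit at t: F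
   has no isolated points, but F `&` [a0, b0] may have some, at a0 or b0. *)
Definition is_Flim g t l : Prop :=
  g y @[y --> within (F `&` `[a0, b0]) t^'] --> l.

Definition Fcontinuous f : Prop :=
  forall t, t \in F `&` `[a0, b0] -> is_Flim f t (f t).

Definition is_Fderive f t l : Prop :=
  if t \in F then
    is_Flim (fun y => (f y - f t) /
                      (staircase F alpha p y - staircase F alpha p t)) t l
  else l = 0.

Definition Fderivable f : Prop :=
  forall t, t \in `[a0, b0] -> exists l, is_Fderive f t l.

(* f solves the fractal equation D f (t) = G t (f t) on F `&` [a0, b0]. *)
Definition Fsolution (G : R -> R -> R) f : Prop :=
  Fderivable f /\
  forall t, t \in F `&` `[a0, b0] -> is_Fderive f t (G t (f t)).

End fractal_derivative.

(* Main.v *)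
Require Import Defs.
From HB Require Import structures.
From mathcomp Require Import all_boot all_order all_algebra.
From mathcomp Require Import all_classical all_reals all_analysis.
From mathcomp Require Import ring lra measurable_realfun.
Import Order.TTheory GRing.Theory Num.Theory.
Import numFieldNormedType.Exports.
Local Open Scope classical_set_scope.
Local Open Scope ring_scope.

(** Put w = y - u, which never vanishes on F within [a0, b0], and take
    v = 1 / w. Subtracting the two Riccati equations gives
    D w = (a + b (y + u)) w, and the reciprocal rule D (1 / w) = - D w / w ^ 2
    turns this into D v = - (a + 2 b u) v - b, because y + u = 2 u + 1 / v.

    The difference rule for the fractal derivative is formal; the reciprocal
    rule ([is_FderiveV]) requires a function that has a fractal derivative at t
    to be F-continuous at t ([is_Fderive_continuous]). That continuity comes
    from f y - f t = q y * (S y - S t), where S is the staircase and q the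
    difference quotient, and uses two properties of S.

    First, S y differs from S t when y in F is close to t and distinct from t:
    otherwise the identity would fail, as a quotient by 0 is 0. If S takes the
    same value at two points, then, being monotone, it is constant in between,
    so that F has no point strictly between them
    ([staircase_near_neq]).

    Second, S is continuous ([staircase_continuous]). An increment of S is
    Gamma (alpha + 1) times the Hausdorff measure of a piece of F
    ([staircaseB]), points are null, and Hausdorff measure is a Borel measure,
    so that continuity from above applies to F intersected with intervals
    shrinking to t ([hausdorff_measure_itv_cvg0]). That Borel sets are
    measurable is Caratheodory's criterion on rays, which has a short proof on
    the line: in a cover by sets of diameter at most d, the sets that straddle
    an endpoint x contribute to the right of x only points of ]x, x + d], a
    single set of cost d ^ s, which vanishes as d tends to 0
    ([hausdorff_content_ray]). *)

(** * Diameters and Hausdorff contents on the line *)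

Section diameter.
Set Implicit Arguments.
Unset Strict Implicit.
Context {R : realType}.
Implicit Types (A B : set R) (r : R).

Lemma diam_ge0 A : (0 <= diam A)%E.
Proof. by apply: ereal_sup_ubound; left. Qed.

Lemma diam_leP A r : 0 <= r ->
  (diam A <= r%:E)%E <-> (forall x y, A x -> A y -> `|x - y| <= r).
Proof.
move=> r0; split=> [dA x y Ax Ay|dA].
  rewrite -lee_fin; apply: le_trans dA; apply: ereal_sup_ubound.
  by right; exists (x, y).
apply: ge_ereal_sup => _ [->|[[x y] /= [Ax Ay] <-]]; first by rewrite lee_fin.
by rewrite lee_fin; exact: dA.
Qed.

Lemma diam_set0 : diam (@set0 R) = 0%E.
Proof. by apply/eqP; rewrite eq_le diam_ge0 andbT; apply/diam_leP. Qed.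

Lemma diam_set1 (x : R) : diam [set x] = 0%E.
Proof.
apply/eqP; rewrite eq_le diam_ge0 andbT; apply/diam_leP => // _ _ -> ->.
by rewrite subrr normr0.
Qed.

End diameter.

Section content.
Set Implicit Arguments.
Unset Strict Implicit.
Context {R : realType} (s : R) (s_gt0 : 0 < s).
Implicit Types (A B : set R) (d : R).
Local Open Scope ereal_scope.

Let s_neq0 : s != 0%R. Proof. by rewrite gt_eqF. Qed.

(** The line with every subset measurable: the covers in [mu_ext] are by
    measurable sets, and those of Hausdorff contents are by arbitrary sets. *)
Definition discrete_line := g_sigma_algebraType (@setT (set R)).

(** The infinite value beyond d moves the constraint on the diameters of a cover
    into its cost. *)
Definition diam_gauge d (B : set discrete_line) : \bar R :=
  if diam B <= d%:E then diam B `^ s else +oo.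

Lemma diam_gauge_ge0 d B : 0 <= diam_gauge d B.
Proof. by rewrite /diam_gauge; case: ifP => _ //; exact: poweR_ge0. Qed.

Lemma diam_gauge0 d : (0 <= d)%R -> diam_gauge d set0 = 0.
Proof. by move=> d0; rewrite /diam_gauge diam_set0 lee_fin d0 poweR0r. Qed.

(** Brings countable subadditivity of contents from the general theory of outer
    measures: a cover using a set of diameter larger than d has infinite cost,
    so that it does not change the infimum. *)
Lemma hausdorff_contentE d : hausdorff_content s d = mu_ext (diam_gauge d).
Proof.
apply/funext => A; apply/eqP; rewrite eq_le; apply/andP; split.
  apply: le_ereal_inf_tmp => _ [B [_ AB] <-].
  have [small|] := pselect (forall i, diam (B i) <= d%:E).
    apply: ereal_inf_lbound; exists B => //.
    by apply: eq_eseriesr => i _; rewrite /diam_gauge small.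
  move=> /existsNP[i /negP Bi]; rewrite (eseries_pinfty _ (k := i)) ?leey//.
    by move=> n _; rewrite gt_eqF// (lt_le_trans _ (diam_gauge_ge0 _ _)).
  by rewrite /diam_gauge (negbTE Bi).
apply: le_ereal_inf_tmp => _ [B [AB small] <-].
apply: ereal_inf_lbound; exists B => //.
  by split=> // i; exact: sub_sigma_algebra.
by apply: eq_eseriesr => i _; rewrite /diam_gauge small.
Qed.

Lemma hausdorff_content_ge0 d A : 0 <= hausdorff_content s d A.
Proof. by rewrite hausdorff_contentE mu_ext_ge0//; exact: diam_gauge_ge0. Qed.

Lemma hausdorff_content_antimono A :
  {homo (fun d => hausdorff_content s d A) : d d' / (d <= d')%R >-> d' <= d}.
Proof.
move=> d d' dd'; apply: ereal_inf_le_tmp => _ [B [AB small] <-].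
by exists B => //; split=> // i; rewrite (le_trans (small i))// lee_fin.
Qed.

Lemma hausdorff_content_cvg A :
  hausdorff_content s d A @[d --> 0^'+] -->
  ereal_sup [set hausdorff_content s d A | d in `]0%R, +oo[].
Proof.
apply: nonincreasing_at_right_cvge => //.
by move=> d d' _ _; exact: hausdorff_content_antimono.
Qed.

Lemma hausdorff_measureE A : hausdorff_measure s A =
  ereal_sup [set hausdorff_content s d A | d in `]0%R, +oo[].
Proof. exact/cvg_lim/hausdorff_content_cvg. Qed.

Lemma hausdorff_content_le_measure d A : (0 < d)%R ->
  hausdorff_content s d A <= hausdorff_measure s A.
Proof.
move=> d0; rewrite hausdorff_measureE; apply: ereal_sup_ubound.
by exists d => //=; rewrite in_itv/= d0.
Qed.

Lemma hausdorff_measure_le A x :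
  (forall d, (0 < d)%R -> hausdorff_content s d A <= x) ->
  hausdorff_measure s A <= x.
Proof.
move=> Ax; rewrite hausdorff_measureE; apply: ge_ereal_sup => _ [d + <-].
by rewrite /= in_itv/= andbT; exact: Ax.
Qed.

Lemma hausdorff_measure_ge0 A : 0 <= hausdorff_measure s A.
Proof.
exact: le_trans (hausdorff_content_ge0 1 A)
  (hausdorff_content_le_measure A ltr01).
Qed.

Lemma hausdorff_measure_set1 (x : R) : hausdorff_measure s [set x] = 0.
Proof.
apply/eqP; rewrite eq_le hausdorff_measure_ge0 andbT.
apply: hausdorff_measure_le => d d0; apply: ereal_inf_lbound.
exists (fun=> [set x]); last first.
  by rewrite eseries0// => i _ _; rewrite diam_set1 poweR0r.
split; first by move=> y ->; exists 0%N.
by move=> i; rewrite diam_set1 lee_fin ltW.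
Qed.

Lemma hausdorff_measure_set0 : hausdorff_measure s set0 = 0.
Proof.
apply/eqP; rewrite eq_le hausdorff_measure_ge0 andbT.
apply: hausdorff_measure_le => d d0.
rewrite hausdorff_contentE mu_ext0// ?diam_gauge0// ?ltW//.
exact: diam_gauge_ge0.
Qed.

Lemma le_hausdorff_measure :
  {homo hausdorff_measure s : A B / A `<=` B >-> A <= B}.
Proof.
move=> A B AB; apply: hausdorff_measure_le => d d0.
apply: le_trans (hausdorff_content_le_measure B d0).
by rewrite hausdorff_contentE; exact: le_mu_ext.
Qed.

Lemma hausdorff_measure_sigma_subadditive :
  sigma_subadditive (hausdorff_measure s).
Proof.
move=> A; apply: hausdorff_measure_le => d d0.
apply: (@le_trans _ _ (\sum_(i <oo) hausdorff_content s d (A i))).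
  rewrite hausdorff_contentE; apply: mu_ext_sigma_subadditive.
  exact: diam_gauge_ge0.
apply: lee_nneseries => [i _ _|i _]; first exact: hausdorff_content_ge0.
exact: hausdorff_content_le_measure.
Qed.

(** From a cover B of A, the sets inside the ray together with ]x, x + d] cover
    the part of A in the ray: a point of the ray lying in a set that leaves the
    ray is at distance at most d from x. The other sets of B cover the rest. *)
Lemma hausdorff_content_ray d x A : (0 < d)%R ->
  hausdorff_content s d (A `&` `]x, +oo[) +
  hausdorff_content s d (A `&` ~` `]x, +oo[) <=
  hausdorff_content s d A + (d `^ s)%:E.
Proof.
move=> d0; rewrite -leeBlDr//; apply: le_ereal_inf_tmp => _ [B [AB small] <-].
rewrite leeBlDr//.
pose C i : set R := if i is j.+1 then
  (if `[< B j `<=` `]x, +oo[ >] then B j else set0)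
  else `]x, (x + d)%R]%classic.
pose D j := if `[< B j `<=` `]x, +oo[ >] then set0 else B j.
have diam0 : diam (C 0%N) <= d%:E.
  apply/diam_leP; first exact: ltW.
  by move=> y z /=; rewrite !in_itv/= => *; rewrite ler_norml; lra.
have coverR : hausdorff_content s d (A `&` `]x, +oo[) <=
    \sum_(0 <= i <oo) (diam (C i) `^ s).
  apply: ereal_inf_lbound; exists C => //; split.
    move=> t [/AB[j _ Bt] /=]; rewrite in_itv/= andbT => xt.
    have [Bj|/existsNP[z /not_implyP[Bz]]] := pselect (B j `<=` `]x, +oo[).
      by exists j.+1 => //=; rewrite asboolT.
    rewrite /= in_itv/= andbT => /negP; rewrite -leNgt => zx.
    exists 0%N => //=; rewrite in_itv/= xt/=.
    have /diam_leP /(_ t z Bt Bz) := small j => /(_ (ltW d0)).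
    by rewrite ler_norml; lra.
  case=> [//|j] /=; case: ifP => _ //.
  by rewrite diam_set0 lee_fin ltW.
have coverL : hausdorff_content s d (A `&` ~` `]x, +oo[) <=
    \sum_(0 <= i <oo) (diam (D i) `^ s).
  apply: ereal_inf_lbound; exists D => //; split.
    move=> t [/AB[j _ Bt] xt]; exists j => //.
    by rewrite /D; case: ifP => // /asboolP /(_ t Bt).
  by move=> j; rewrite /D; case: ifP => _ //; rewrite diam_set0 lee_fin ltW.
apply: le_trans (leeD coverR coverL) _.
rewrite nneseries_recl//; last by move=> *; exact: poweR_ge0.
rewrite -addeA addeC leeD//; last first.
  rewrite -poweR_EFin gt0_ler_poweR// ?in_itv/= ?leey ?andbT ?diam_ge0//.
    exact: ltW.
  by rewrite lee_fin ltW.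
rewrite -(nneseries_addn 1)//; last by move=> *; exact: poweR_ge0.
rewrite -nneseriesD; [|by move=> *; exact: poweR_ge0..].
apply: lee_nneseries => [i _ _|i _].
  by rewrite adde_ge0// poweR_ge0.
rewrite addn1 /D /=.
by case: ifP => _; rewrite diam_set0 poweR0r// ?adde0 ?add0e.
Qed.

Lemma hausdorff_measure_ray x A :
  hausdorff_measure s (A `&` `]x, +oo[) +
  hausdorff_measure s (A `&` ~` `]x, +oo[) <= hausdorff_measure s A.
Proof.
have cvgH B : hausdorff_content s d B @[d --> 0^'+] --> hausdorff_measure s B.
  by rewrite hausdorff_measureE; exact: hausdorff_content_cvg.
have lhs : (hausdorff_content s d (A `&` `]x, +oo[) +
    hausdorff_content s d (A `&` ~` `]x, +oo[)) @[d --> 0^'+] -->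
    hausdorff_measure s (A `&` `]x, +oo[) +
    hausdorff_measure s (A `&` ~` `]x, +oo[).
  by apply: cvgeD => //; rewrite ge0_adde_def// inE hausdorff_measure_ge0.
have rhs : (hausdorff_content s d A + (d `^ s)%:E) @[d --> 0^'+] -->
    hausdorff_measure s A.
  rewrite -[X in _ --> X]adde0; apply: cvgeD => //.
    by rewrite fin_num_adde_defl.
  by apply: cvg_EFin; [exact: nearW|exact: powR_cvg0].
apply: (lee_cvg_to lhs rhs); near=> d.
by apply: hausdorff_content_ray; near: d; exact: nbhs_right_gt.
Unshelve. all: by end_near. Qed.

End content.

(** * Hausdorff measure as a Borel measure *)

Section hausdorff_borel.
Set Implicit Arguments.
Unset Strict Implicit.
Context {R : realType} (s : R) (s_gt0 : 0 < s).
Implicit Types (A F : set R) (x y z t : R).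
Local Open Scope ereal_scope.

Definition hausdorff_outer_measure : {outer_measure set R -> \bar R} :=
  HB.pack (hausdorff_measure s)
    (isOuterMeasure.Build R R (hausdorff_measure s)
      (hausdorff_measure_set0 s_gt0) (hausdorff_measure_ge0 s)
      (le_hausdorff_measure s) (hausdorff_measure_sigma_subadditive s)).

Let H := hausdorff_outer_measure.

Lemma ray_caratheodory x : H.-caratheodory `]x, +oo[.
Proof.
by apply: le_caratheodory_measurable => A; exact: hausdorff_measure_ray.
Qed.

(** Rays generate the Borel sets, and Caratheodory measurable sets form a sigma
    algebra. *)
Lemma borel_caratheodory A : measurable A -> H.-caratheodory A.
Proof.
rewrite -[measurable A]/((@ocitv R).-sigma.-measurable A).
rewrite RGenOInfty.measurableE.
apply: smallest_sub => [|_ [x ->]]; last exact: ray_caratheodory.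
split.
- exact: caratheodory_measurable_set0.
- by move=> B mB; rewrite setTD; exact: caratheodory_measurable_setC.
- exact: caratheodory_measurable_bigcup.
Qed.

(** The cut is a ray; the shared endpoint y may be counted on both sides because
    points are null. *)
Lemma hausdorff_measure_itv_cat F x y z : (x <= y)%R -> (y <= z)%R ->
  hausdorff_measure s (F `&` `[x, z]) =
  hausdorff_measure s (F `&` `[x, y]) + hausdorff_measure s (F `&` `[y, z]).
Proof.
move=> xy yz.
have -> : hausdorff_measure s (F `&` `[y, z]) =
    hausdorff_measure s (F `&` `]y, z]).
  apply/eqP; rewrite eq_le; apply/andP; split; last first.
    apply: le_hausdorff_measure => // t [Ft /=].
    by rewrite !in_itv/= => /andP[/ltW yt tz]; rewrite yt tz.
  apply: (@le_trans _ _ (H (F `&` `]y, z] `|` [set y]))).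
    apply: le_hausdorff_measure => // t [Ft /=].
    rewrite in_itv/= le_eqVlt => /andP[/predU1P[->|yt] tz]; first by right.
    by left; split => //=; rewrite in_itv/= yt.
  apply: le_trans (outer_measureU2 _ _ _) _.
  by rewrite /H/= hausdorff_measure_set1// adde0.
rewrite -[LHS]/(H _) (ray_caratheodory y) addeC; congr (_ + _).
  congr (hausdorff_measure _ _); apply/seteqP; split => t /=; rewrite !in_itv/=.
    by move=> [[Ft /andP[-> _]] /negP]; rewrite andbT -leNgt.
  move=> [Ft /andP[-> ty]]; rewrite (le_trans ty yz); split => //.
  by rewrite andbT => /lt_geF; rewrite ty.
congr (hausdorff_measure _ _); apply/seteqP; split => t /=; rewrite !in_itv/=.
  by move=> [[Ft /andP[_ ->]]]; rewrite !andbT.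
by move=> [Ft /andP[yt ->]]; rewrite yt (le_trans xy (ltW yt)).
Qed.

(** Continuity from above: the intersection of the shrinking pieces is contained
    in the null set reduced to t. *)
Lemma hausdorff_measure_itv_cvg0 F t : measurable F ->
  hausdorff_measure s (F `&` `[(t - 1)%R, (t + 1)%R]) < +oo ->
  hausdorff_measure s (F `&` `[(t - n.+1%:R^-1)%R, (t + n.+1%:R^-1)%R])
    @[n --> \oo] --> 0.
Proof.
move=> mF fin.
pose J n := F `&` `[(t - n.+1%:R^-1)%R, (t + n.+1%:R^-1)%R].
have mJ n : H.-cara.-measurable (J n).
  by apply: borel_caratheodory; apply: measurableI.
have mJ0 : H.-cara.-measurable (\bigcap_n J n).
  exact: (@bigcapT_measurable _ (caratheodory_type H)).
have capJ : H (\bigcap_n J n) = 0.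
  apply/eqP; rewrite eq_le outer_measure_ge0 andbT.
  rewrite -(hausdorff_measure_set1 s_gt0 t); apply: le_outer_measure => y Jy /=.
  apply/eqP; rewrite -subr_eq0 -normr_eq0 eq_le normr_ge0 andbT.
  apply/(@ler_addgt0Pr R) => e e0; rewrite add0r.
  have [n _ /(_ n (leqnn n)) ne] := near_infty_natSinv_lt (PosNum e0).
  have {}ne : (n.+1%:R^-1 < e)%R := ne.
  have [_ /=] := Jy n I; rewrite in_itv/= => yt.
  by move: ne yt; move: (n.+1%:R^-1)%R => w; rewrite ler_norml; lra.
rewrite -capJ.
apply: (@nonincreasing_cvg_mu _ (caratheodory_type H) R H J) => //.
  by rewrite /J invr1.
apply/nonincreasing_seqP => n; apply/subsetPset => y [Fy /= yt]; split => //=.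
have : (n.+2%:R^-1 <= n.+1%:R^-1 :> R)%R by rewrite lef_pV2 ?posrE// ler_nat.
move: yt; rewrite !in_itv/=; move: (_^-1)%R (_^-1)%R => v w; lra.
Qed.

End hausdorff_borel.

(** * The staircase function *)

Lemma Gamma_ge0 {R : realType} (x : R) : 0 <= Gamma x.
Proof.
by apply: Rintegral_ge0 => t _; rewrite mulr_ge0 ?powR_ge0 ?expR_ge0.
Qed.

Section staircase_theory.
Set Implicit Arguments.
Unset Strict Implicit.
Context {R : realType} (F : set R) (alpha p : R).
Hypotheses (alpha_gt0 : 0 < alpha) (measF : measurable F)
  (F_perfect : alpha_perfect F alpha p) (F_nonempty : F !=set0).
Implicit Types (x y z t : R).

Local Notation S := (staircase F alpha p).
Local Notation hausF x y := (hausdorff_measure alpha (F `&` `[x, y])).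

(** If this value of Gamma were 0, the staircase would be identically 0, and
    its set of non-constancy F would be empty. *)
Lemma alpha_perfect_Gamma_gt0 : 0 < Gamma (alpha + 1).
Proof.
have [_ FE _] := F_perfect; have [t Ft] := F_nonempty.
rewrite lt_neqAle Gamma_ge0 andbT; apply/negP => /eqP G0.
have S0 y : S y = 0.
  by rewrite /staircase /estaircase -G0; case: ifP => _; rewrite mul0e ?oppe0.
by move: Ft; rewrite FE; apply; near=> y; rewrite !S0.
Unshelve. all: by end_near. Qed.

(** The product of Gamma (alpha + 1) with the measure is finite, and a positive
    factor cannot hide an infinite measure. *)
Lemma hausdorff_measure_itv_lty x y : (hausF x y < +oo)%E.
Proof.
have [finS _ _] := F_perfect.
have ge0 := hausdorff_measure_ge0 alpha.
have fin t : (hausF p t < +oo)%E /\ (hausF t p < +oo)%E.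
  have decr (A : set R) : ((Gamma (alpha + 1))%:E * hausdorff_measure alpha A
      \is a fin_num)%E -> (hausdorff_measure alpha A < +oo)%E.
    have := ge0 A; case: (hausdorff_measure alpha A) => [r| |]//= _.
      by rewrite ltry.
    by rewrite gt0_muley ?lte_fin ?alpha_perfect_Gamma_gt0.
  have := finS t; rewrite /estaircase; have [pt /decr fint|tp] := leP p t.
    split=> //; apply: le_lt_trans fint.
    apply: le_hausdorff_measure => z [Fz /=].
    by rewrite !in_itv/= => ?; split => //; lra.
  rewrite fin_numN => /decr fint; split=> //.
  apply: le_lt_trans fint; apply: le_hausdorff_measure => z [Fz /=].
  by rewrite !in_itv/= => ?; split => //; lra.
apply: (@le_lt_trans _ _ (hausF x p + hausF p y)%E).
  apply: le_trans (outer_measureU2 (hausdorff_outer_measure alpha_gt0) _ _).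
  apply: le_hausdorff_measure => z [Fz /=]; rewrite in_itv/= => xzy.
  have [zp|pz] := leP z p; [left|right]; split => //=; rewrite in_itv/=; lra.
by rewrite lte_add_pinfty ?(fin x).2 ?(fin y).1.
Qed.

Let mass x y := fine (hausF x y).

Let mass_fin x y : hausF x y \is a fin_num.
Proof.
rewrite ge0_fin_numE; first exact: hausdorff_measure_itv_lty.
exact: hausdorff_measure_ge0.
Qed.

Let mass_cat x y z : x <= y -> y <= z -> mass x z = mass x y + mass y z.
Proof.
move=> xy yz; rewrite /mass.
by rewrite (hausdorff_measure_itv_cat alpha_gt0 _ xy yz) fineD.
Qed.

Lemma staircaseE t : S t = if p <= t then Gamma (alpha + 1) * mass p t
  else - (Gamma (alpha + 1) * mass t p).
Proof.
by rewrite /staircase /estaircase; case: ifP => _; rewrite ?fineN fineM.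
Qed.

(** The base point p cancels by additivity over adjacent intervals, whatever its
    position with respect to x and y. *)
Lemma staircaseB x y : x <= y ->
  S y - S x = Gamma (alpha + 1) * fine (hausF x y).
Proof.
move=> xy; rewrite -/(mass x y) !staircaseE.
have [px|xp] := leP p x.
  by rewrite (le_trans px xy) (mass_cat px xy); ring.
have [py|yp] := leP p y; first by rewrite (mass_cat (ltW xp) py); ring.
by rewrite (mass_cat xy (ltW yp)); ring.
Qed.

Lemma staircase_ndecr : {homo S : x y / x <= y}.
Proof.
move=> x y xy; rewrite -subr_ge0 staircaseB// mulr_ge0 ?Gamma_ge0//.
by rewrite fine_ge0// hausdorff_measure_ge0.
Qed.

(** Near t, both S y and S t lie between the values of S at t - r and t + r,
    whose difference is the mass of F between these points. *)
Lemma staircase_continuous : continuous S.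
Proof.
move=> t; apply/cvgrPdist_le => e e0.
pose r n : R := n.+1%:R^-1.
have : Gamma (alpha + 1) * mass (t - r n) (t + r n) @[n --> \oo] --> 0.
  rewrite -[X in _ --> X](mulr0 (Gamma (alpha + 1))); apply: cvgMr.
  apply: fine_cvg.
  exact: hausdorff_measure_itv_cvg0 (hausdorff_measure_itv_lty _ _).
move=> /cvgrPdist_le /(_ e e0)[n _ /(_ n (leqnn n)) /=].
have r0 : 0 < r n by rewrite invr_gt0.
rewrite sub0r normrN -staircaseB; last lra.
move=> /ler_normlW Sn; near=> y.
have : `|t - y| <= r n by near: y; apply: cvgr_dist_le.
rewrite ler_norml => ty.
have lo : S (t - r n) <= S y by apply: staircase_ndecr; lra.
have hi : S y <= S (t + r n) by apply: staircase_ndecr; lra.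
have lo' : S (t - r n) <= S t by apply: staircase_ndecr; lra.
have hi' : S t <= S (t + r n) by apply: staircase_ndecr; lra.
by rewrite ler_norml; lra.
Unshelve. all: by end_near. Qed.

(** By monotonicity S is constant between x and y, and no point at which S is
    locally constant belongs to F. *)
Lemma staircase_flat_gap x y z : S x = S y -> x < z < y -> ~ F z.
Proof.
move=> Sxy /andP[xz zy]; have [_ -> _] := F_perfect; apply.
have flat w : x < w < y -> S w = S x.
  move=> /andP[xw wy]; apply/eqP; rewrite eq_le {1}Sxy.
  by rewrite !staircase_ndecr// ltW.
near=> w; rewrite !flat//; first by rewrite xz zy.
apply/andP; split; near: w.
  exact: (cvgr_gt _ cvg_id).
exact: (cvgr_lt _ cvg_id).
Unshelve. all: by end_near. Qed.

(** On each side of t, either S never takes the value S t again, or it does so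
    at some z, and then F has no point between t and z. *)
Lemma staircase_near_neq t : \forall y \near t^', F y -> S y != S t.
Proof.
have right : \forall y \near t, t < y -> F y -> S y != S t.
  have [[z [tz Sz]]|nz] := pselect (exists z, t < z /\ S z = S t).
    near=> y => ty Fy; exfalso.
    apply: (@staircase_flat_gap t z y) => //; rewrite ty/=.
    near: y; exact: (cvgr_lt _ cvg_id).
  by near=> y => ty _; apply/eqP => Sy; apply: nz; exists y.
have left : \forall y \near t, y < t -> F y -> S y != S t.
  have [[z [zt Sz]]|nz] := pselect (exists z, z < t /\ S z = S t).
    near=> y => yt Fy; exfalso.
    apply: (@staircase_flat_gap z t y) => //; rewrite yt andbT.
    near: y; exact: (cvgr_gt _ cvg_id).
  by near=> y => yt _; apply/eqP => Sy; apply: nz; exists y.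
rewrite near_withinE; near=> y => yt.
move: yt; rewrite neq_lt => /orP[yt|ty] Fy.
  by move: yt Fy; near: y.
by move: ty Fy; near: y.
Unshelve. all: by end_near. Qed.

End staircase_theory.

(** * Fractal derivatives *)

Section fractal_calculus.
Set Implicit Arguments.
Unset Strict Implicit.
Context {R : realType} (F : set R) (alpha p a0 b0 : R).
Hypotheses (alpha_gt0 : 0 < alpha) (measF : measurable F)
  (F_perfect : alpha_perfect F alpha p).
Implicit Types (f g : R -> R) (t l m : R).

Local Notation S := (staircase F alpha p).
Local Notation Flim := (is_Flim F a0 b0).
Local Notation Fderive := (is_Fderive F alpha p a0 b0).

(** Here f y = q y * (S y - S t) + f t for the difference quotient q, which
    tends to l, while S y - S t tends to 0. *)
Lemma is_Fderive_continuous f t l :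
  t \in F -> Fderive f t l -> Flim f t (f t).
Proof.
move=> tF; rewrite /is_Fderive tF => fl.
have F0 : F !=set0 by exists t; exact: set_mem.
have SS : S y - S t @[y --> within (F `&` `[a0, b0]) t^'] --> 0.
  rewrite -(subrr (S t)); apply: cvgB; last exact: cvg_cst.
  apply: cvg_within_filter; apply: cvg_within_filter.
  exact: staircase_continuous.
have lim : (f y - f t) / (S y - S t) * (S y - S t) + f t
    @[y --> within (F `&` `[a0, b0]) t^'] --> l * 0 + f t.
  by apply: cvgD; [exact: cvgM|exact: cvg_cst].
rewrite mulr0 add0r in lim; apply: cvg_trans lim; apply: near_eq_cvg.
rewrite near_withinE.
near=> y => -[Fy _].
have Syt : S y - S t != 0.
  by rewrite subr_eq0; move: Fy; near: y; exact: staircase_near_neq.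
by rewrite /= divfK// subrK.
Unshelve. all: by end_near. Qed.

Lemma is_FderiveB f g t l m :
  Fderive f t l -> Fderive g t m -> Fderive (fun y => f y - g y) t (l - m).
Proof.
rewrite /is_Fderive; case: ifP => _ fl gm; last by rewrite fl gm subr0.
apply: (cvg_trans _ (cvgB fl gm)); apply: near_eq_cvg; near=> y.
by rewrite /= fctE -mulrBl; congr (_ / _); ring.
Unshelve. all: by end_near. Qed.

(** The quotient of 1 / f at y is - q y / (f y * f t), with q that of f, and
    f y tends to f t by continuity. *)
Lemma is_FderiveV f t l : f t != 0 ->
  Fderive f t l -> Fderive (fun y => (f y)^-1) t (- l / f t ^+ 2).
Proof.
move=> ft0 fl; have := fl; rewrite /is_Fderive.
case: ifPn => [tF ql|_ ->]; last by rewrite oppr0 mul0r.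
have ft := is_Fderive_continuous tF fl.
have -> : - l / f t ^+ 2 = - (l * (f t)^-1 * (f t)^-1).
  by rewrite expr2 invfM mulNr mulrA.
have lim : - ((f y - f t) / (S y - S t) * (f y)^-1 * (f t)^-1)
    @[y --> within (F `&` `[a0, b0]) t^'] --> - (l * (f t)^-1 * (f t)^-1).
  by apply: cvgN; apply: cvgM; [apply: cvgM => //; exact: cvgV|exact: cvg_cst].
apply: cvg_trans lim; apply: near_eq_cvg.
near=> y.
have fy0 : f y != 0 by near: y; exact: (cvgr_neq0 _ ft ft0).
by rewrite /=; move: (S y - S t)^-1 => d; field; rewrite fy0 ft0.
Unshelve. all: by end_near. Qed.

End fractal_calculus.

(** * The Riccati equation *)

Theorem proposition4p2 (R : realType) (alpha : R) (F : set R) (a0 b0 p : R)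
    (a b c u y : R -> R)
    (halpha : 0 < alpha <= 1)
    (hFI : F `&` `[a0, b0] !=set0)
    (hp : p \in `[a0, b0])
    (hFcompact : compact F)
    (hFdim : hausdorff_dim F = alpha%:E)
    (hFperfect : alpha_perfect F alpha p)
    (ha : Fcontinuous F a0 b0 a)
    (hb : Fcontinuous F a0 b0 b)
    (hc : Fcontinuous F a0 b0 c)
    (hb0 : exists2 t, t \in F `&` `[a0, b0] & b t != 0)
    (hc0 : exists2 t, t \in F `&` `[a0, b0] & c t != 0)
    (hu : Fsolution F alpha p a0 b0
            (fun t x => a t * x + b t * x ^+ 2 + c t) u)
    (hy : Fsolution F alpha p a0 b0
            (fun t x => a t * x + b t * x ^+ 2 + c t) y)
    (hyu : forall t, t \in F `&` `[a0, b0] -> y t != u t) :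
  exists2 v : R -> R,
    Fsolution F alpha p a0 b0
      (fun t x => - (a t + 2 * b t * u t) * x - b t) v &
    forall t, t \in F `&` `[a0, b0] -> v t != 0 /\ y t = u t + 1 / v t.
Proof.
have alpha_gt0 : 0 < alpha by case/andP: halpha.
have measF := compact_measurable hFcompact.
have w_neq0 t : t \in F `&` `[a0, b0] -> y t - u t != 0.
  by move=> tK; rewrite subr_eq0 hyu.
exists (fun t => (y t - u t)^-1); last first.
  move=> t tK; rewrite invr_eq0 w_neq0//; split=> //.
  by rewrite div1r invrK addrC subrK.
have v_derive t : t \in F `&` `[a0, b0] ->
    is_Fderive F alpha p a0 b0 (fun s => (y s - u s)^-1) t
      (- (a t + 2 * b t * u t) * (y t - u t)^-1 - b t).
  move=> tK; have w0 := w_neq0 t tK.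
  have w_derive := is_FderiveB (hy.2 t tK) (hu.2 t tK).
  have := is_FderiveV alpha_gt0 measF hFperfect
    (f := fun s => y s - u s) w0 w_derive.
  by congr is_Fderive; field.
split=> // t tab; have [tF|tF] := boolP (t \in F).
  by eexists; apply: v_derive; rewrite inE; split => //; exact: set_mem.
by exists 0; rewrite /is_Fderive (negbTE tF).
Qed.
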